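(* Let $\lambda > 0$, let $X$ be a Poisson random variable with mean $\lambda$, and let $b \geq 2$ be an integer. Then for any $k \in \{0,1,\dots,b-1\}$, $$\left| \mathbb{P}\left[X \equiv k \ (\mathrm{mod}\ b)\right] - \frac{1}{b} \right| \leq \frac{1}{b} \sum_{j=1}^{b-1} \exp\left(-\lambda(1-\cos(2\pi j/b))\right) \leq \frac{b-1}{b} \exp\left(-\lambda(1-\cos(2\pi/b))\right).$$ *)

(* Defs.v *)
From mathcomp Require Import all_boot all_order all_algebra.
From mathcomp Require Import all_classical all_reals all_analysis.

Set Implicit Arguments.
Unset Strict Implicit.
Unset Printing Implicit Defensive.

(* The library's [poisson_prob rate] takes a vacuous index of type [nat], on
   which its value does not depend; it is set to 0 here.  The sigma-algebra on
   [nat] is discrete, so equality on all sets is equality of laws. *)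
Definition is_poisson (d : measure_display) (T : measurableType d)
    (R : realType) (P : probability T R) (X : {RV P >-> nat}) (rate : R) : Prop :=
  distribution P X = poisson_prob rate 0%N :> (set nat -> \bar R).

(* Main.v *)
Require Import Defs.
From mathcomp Require Import all_boot all_order all_algebra.
From mathcomp Require Import all_classical all_reals all_analysis.
From mathcomp Require Import ring lra.
Import Order.TTheory GRing.Theory Num.Theory.
Import numFieldNormedType.Exports.
Local Open Scope classical_set_scope.
Local Open Scope ring_scope.

(** The inequality is a Fourier argument on the group of residues modulo b,
carried out with real trigonometric functions only.

Write t_j = 2 pi j / b.  Averaging cos (m t_j) over j = 0, ..., b - 1 gives 1
when b divides m and 0 otherwise ([sum_cos_roots]).  Taking m = n + (b - k),
a natural number that b divides exactly when n is congruent to k, and summing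
against the Poisson weights exp (- lambda) lambda^n / n!, one gets
([poisson_prob_mod])
  P (X = k mod b) = 1/b sum_j exp (- lambda) G_j (lambda),
where G_j (x) = sum_n cos (n t_j + (b - k) t_j) x^n / n!.  The term j = 0 is
exactly 1/b, so the deviation from 1/b is the sum of the other terms.

Each G_j is the real part of exp (x e^(i t_j) + i (b - k) t_j), hence is at
most exp (x cos t_j) in absolute value ([norm_egf_cos_le]); this yields the
first bound.  Instead of complex exponentials, the proof uses the companion
series H_j with sin in place of cos.  Since termwise differentiation shifts
the coefficients, the addition formulas give the linear system
  G' = cos t G - sin t H,   H' = sin t G + cos t H,
so G^2 + H^2 satisfies y' = 2 cos t y and equals exp (2 x cos t)
([sqr_egf_cos_sin]).

The second bound compares the b - 1 summands with the largest one: for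
0 < j < b the angle t_j lies between t_1 and 2 pi - t_1, where the cosine
is at most cos t_1 ([cos_root_le]). *)

(** * Exponential generating functions *)

Definition egf_terms {R : realType} (c : R^nat) : R^nat :=
  fun n => c n / n`!%:R.

(** The exponential generating function of [c]; its value is meaningful at
every point as soon as [c] is bounded. *)
Definition egf {R : realType} (c : R^nat) (x : R) : R :=
  limn (pseries (egf_terms c) x).

Lemma is_cvg_egf {R : realType} (c : R^nat) (M x : R) :
  (forall n, `|c n| <= M) -> cvgn (pseries (egf_terms c) x).
Proof.
move=> cM; apply: normed_cvg.
apply: (@series_le_cvg _ _ (M \*o exp_coeff `|x|)) => [n|n|n|] //=.
- apply: mulr_ge0; last by rewrite exp_coeff_ge0.
  exact: le_trans (cM n).
- rewrite /exp_coeff /= !normrM normfV normrX (ger0_norm (ler0n _ _)).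
  by rewrite [leLHS]mulrAC -mulrA ler_wpM2r // divr_ge0 ?exprn_ge0.
- by apply: is_cvg_seriesZ; exact: is_cvg_series_exp_coeff.
Qed.

(** Differentiation acts on exponential generating functions as the shift of
the coefficients. *)
Lemma is_derive_egf {R : realType} (c : R^nat) (M x : R) :
  (forall n, `|c n| <= M) ->
  is_derive x 1 (egf c) (egf (fun n => c n.+1) x).
Proof.
have diffsE (u : R^nat) :
    pseries_diffs (egf_terms u) = egf_terms (fun n => u n.+1).
  apply/funext => n; rewrite /pseries_diffs /egf_terms factS natrM invfM.
  by rewrite mulrCA mulVKf // pnatr_eq0.
move=> cM; rewrite /egf -diffsE.
(* Any point of modulus larger than that of x would do: convergence holds
   everywhere. *)
apply: (@pseries_snd_diffs _ _ (`|x| + 1)); rewrite ?diffsE.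
- exact: is_cvg_egf cM.
- by apply: (is_cvg_egf _ M) => n.
- by apply: (is_cvg_egf _ M) => n.
- by rewrite [ltRHS]ger0_norm ?ltrDl // addr_ge0.
Qed.

Lemma egf_at0 {R : realType} (c : R^nat) : egf c 0 = c 0%N.
Proof.
apply: lim_near_cst => //; near=> n.
rewrite /pseries /series /= -[n]prednK; last by near: n; exact: nbhs_infty_gt.
rewrite big_nat_recl //= big1 => [|i _]; last by rewrite expr0n mulr0.
by rewrite /egf_terms fact0 divr1 mulr1 addr0.
Unshelve. all: by end_near. Qed.

Lemma egf_comb {R : realType} (c u : R^nat) (M a b x : R) :
  (forall n, `|c n| <= M) -> (forall n, `|u n| <= M) ->
  egf (fun n => a * c n + b * u n) x = a * egf c x + b * egf u x.
Proof.
move=> /is_cvg_egf cM /is_cvg_egf uM; apply/cvg_lim => //.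
rewrite (_ : pseries _ x = (fun n => a * pseries (egf_terms c) x n
                                   + b * pseries (egf_terms u) x n)).
  by apply: cvgD; apply: cvgMr; [exact: cM|exact: uM].
apply/funext => n; rewrite /pseries /series /= !mulr_sumr -big_split /=.
by apply: eq_bigr => i _; rewrite /egf_terms; ring.
Qed.

Lemma egf_sum {R : realType} (I : Type) (s : seq I) (c : I -> R^nat) (M x : R) :
  (forall i n, `|c i n| <= M) ->
  pseries (egf_terms (fun n => \sum_(i <- s) c i n)) x @ \oo
    --> \sum_(i <- s) egf (c i) x.
Proof.
move=> cM; elim: s => [|i s IHs].
  rewrite big_nil (_ : pseries _ x = fun=> 0); first exact: cvg_cst.
  apply/funext => n; rewrite /pseries /series /= big1 // => m _.
  by rewrite /egf_terms big_nil !mul0r.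
rewrite big_cons (_ : pseries _ x = (fun n => pseries (egf_terms (c i)) x n
   + pseries (egf_terms (fun n => \sum_(i <- s) c i n)) x n)).
  by apply: cvgD IHs; exact: is_cvg_egf (cM i).
apply/funext => n; rewrite /pseries /series /= -big_split /=.
by apply: eq_bigr => m _; rewrite /egf_terms big_cons; ring.
Qed.

(** * The series of cosines along an arithmetic progression of angles *)

(** The squared modulus of exp (x e^(i t) + i p).  Shifting n turns the angle
by t, so the two series solve a linear system whose matrix is a rotation; the
sum of their squares times exp (- 2 x cos t) has derivative zero and is 1 at
the origin. *)
Lemma sqr_egf_cos_sin {R : realType} (t p x : R) :
  egf (fun n => cos (n%:R * t + p)) x ^+ 2
    + egf (fun n => sin (n%:R * t + p)) x ^+ 2 = expR (2 * cos t * x).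
Proof.
pose c n := cos (n%:R * t + p); pose s n := sin (n%:R * t + p).
have c1 n : `|c n| <= 1 by exact: cos_max.
have s1 n : `|s n| <= 1 by exact: sin_max.
have angleS n : n.+1%:R * t + p = t + (n%:R * t + p).
  by rewrite -nat1r; ring.
have dc (y : R) : is_derive y (1 : R) (egf c) (cos t * egf c y + (- sin t) * egf s y).
  rewrite -(egf_comb _ _ _ _ _ _ c1 s1).
  rewrite (_ : (fun n => _) = (fun n => c n.+1)); first exact: is_derive_egf c1.
  by apply/funext => n; rewrite /c angleS cosD /c /s mulNr.
have ds (y : R) : is_derive y (1 : R) (egf s) (sin t * egf c y + cos t * egf s y).
  rewrite -(egf_comb _ _ _ _ _ _ c1 s1).
  rewrite (_ : (fun n => _) = (fun n => s n.+1)); first exact: is_derive_egf s1.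
  by apply/funext => n; rewrite /s angleS sinD /c /s.
pose F y := (egf c y ^+ 2 + egf s y ^+ 2) * expR (- (2 * cos t * y)).
have F1 : F x = 1.
  transitivity (F 0).
    apply: is_derive_0_is_cst => y; apply: trigger_derive.
    rewrite /GRing.scale /=; ring.
  by rewrite /F !egf_at0 mulr0 oppr0 expR0 mulr1 cos2Dsin2.
move: F1; rewrite /F expRN => F1.
by apply: (divIf (lt0r_neq0 (expR_gt0 (2 * cos t * x)))); rewrite F1 divff ?expR_eq0.
Qed.

Lemma norm_egf_cos_le {R : realType} (t p x : R) :
  `|egf (fun n => cos (n%:R * t + p)) x| <= expR (x * cos t).
Proof.
rewrite -(@ler_pXn2r _ 2) ?nnegrE ?expR_ge0 // real_normK ?num_real //.
rewrite -expRM_natl (_ : 2 * (x * cos t) = 2 * cos t * x); last by ring.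
by rewrite -(sqr_egf_cos_sin t p x) lerDl sqr_ge0.
Qed.

Lemma egf1 {R : realType} (x : R) : egf (fun=> 1) x = expR x.
Proof.
rewrite expRE /egf; congr (limn (pseries _ x)).
by apply/funext => n; rewrite /egf_terms mul1r.
Qed.

(** * Averages and comparison of cosines of multiples of 2 pi / b *)

Lemma cosDn2pi {R : realType} (n : nat) (x : R) : cos (x + n%:R * (2 * pi)) = cos x.
Proof.
rewrite -[RHS](periodicn (@cosD2pi R) n); congr cos.
by ring.
Qed.

(** The Dirichlet kernel, cleared of its denominator: 2 sin (x / 2) cos (j x)
telescopes. *)
Lemma sum_cos_dirichlet {R : realType} (n : nat) (x : R) :
  2 * sin (x / 2) * \sum_(0 <= j < n) cos (j%:R * x)
  = sin (n%:R * x - x / 2) + sin (x / 2).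
Proof.
elim: n => [|n IHn].
  by rewrite big_nil mulr0 mul0r add0r sinN addNr.
rewrite big_nat_recr //= mulrDr IHn.
rewrite (_ : n.+1%:R * x - x / 2 = n%:R * x + x / 2); last first.
  by rewrite -nat1r; field.
by rewrite sinB sinD; ring.
Qed.

(** Orthogonality of characters modulo b.  Replacing m by its remainder r
changes the angles by multiples of 2 pi; for r <> 0 the Dirichlet kernel at
x = 2 pi r / b vanishes, since b x is a multiple of 2 pi while x / 2 = pi r / b
lies strictly between 0 and pi. *)
Lemma sum_cos_roots {R : realType} (b m : nat) : (0 < b)%N ->
  \sum_(0 <= j < b) cos (m%:R * (2 * pi * j%:R / b%:R)) = (b %| m)%:R * b%:R :> R.
Proof.
move=> b0; have bR : b%:R != 0 :> R by rewrite pnatr_eq0 -lt0n.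
pose x : R := 2 * pi * (m %% b)%:R / b%:R.
have -> : \sum_(0 <= j < b) cos (m%:R * (2 * pi * j%:R / b%:R))
        = \sum_(0 <= j < b) cos (j%:R * x).
  apply: eq_bigr => j _; rewrite -(cosDn2pi (j * (m %/ b)) (j%:R * x)).
  congr cos; rewrite {1}(divn_eq m b) /x !(natrD, natrM); field.
  by rewrite bR.
have [bm|bNm] := boolP (b %| m)%N.
  under eq_bigr do rewrite /x (eqP bm) mulr0 mul0r mulr0 cos0.
  by rewrite sumr_const_nat subn0 mul1r.
rewrite mul0r.
have sx : sin (x / 2) > 0.
  apply: sin_gt0_pi; rewrite (_ : x / 2 = pi * ((m %% b)%:R / b%:R)); last first.
    by rewrite /x; field.
  have bp : 0 < b%:R :> R by rewrite ltr0n.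
  have mp : 0 < (m %% b)%:R :> R by rewrite ltr0n lt0n.
  rewrite mulr_gt0 ?pi_gt0 ?divr_gt0 //=.
  by rewrite gtr_pMr ?pi_gt0 // ltr_pdivrMr // mul1r ltr_nat ltn_mod.
apply/eqP; have := sum_cos_dirichlet b x.
rewrite (_ : b%:R * x - x / 2 = - (x / 2) + (m %% b)%:R * (2 * pi)); last first.
  by rewrite /x; field.
rewrite -(cosBpihalf (_ + _)) addrAC cosDn2pi cosBpihalf sinN addNr => /eqP.
by rewrite !mulf_eq0 pnatr_eq0 /= (gt_eqF sx).
Qed.

(** The cosine decreases on [0, pi] and is symmetric about pi. *)
Lemma cos_le_cos {R : realType} (x y : R) :
  0 <= x <= pi -> x <= y <= 2 * pi - x -> cos y <= cos x.
Proof.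
move=> /andP[x0 xpi] /andP[xy yx].
have cos_anti (z : R) : x <= z <= pi -> cos z <= cos x.
  move=> /andP[xz zpi]; rewrite leNgt ltr_cos -?leNgt // in_itv /= ?x0 //.
  by rewrite zpi andbT (le_trans x0).
have [ypi|piy] := lerP y pi; first by apply: cos_anti; rewrite xy.
rewrite -cosN -(cosDn2pi 1); apply: cos_anti; rewrite mul1r.
by apply/andP; split; lra.
Qed.

Lemma cos_root_le {R : realType} (b j : nat) : (0 < j < b)%N ->
  cos (2 * pi * j%:R / b%:R) <= cos (2 * pi / b%:R) :> R.
Proof.
move=> /andP[j0 jb].
have b0 : 0 < b%:R :> R by rewrite ltr0n (leq_ltn_trans _ jb).
have pi0 := pi_gt0 R.
have b2 : 2 <= b%:R :> R by rewrite (ler_nat _ 2) (leq_ltn_trans j0 jb).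
have j1 : 1 <= j%:R :> R by rewrite (ler_nat _ 1).
have jb1 : j%:R + 1 <= b%:R :> R by rewrite natr1 ler_nat.
apply: cos_le_cos; apply/andP; split.
- by rewrite divr_ge0 ?mulr_ge0 // ltW.
- by rewrite ler_pdivrMr // mulrC ler_pM2l.
- by rewrite ler_pM2r ?invr_gt0 // ler_peMr // mulr_ge0 ?ltW.
- rewrite lerBrDr -mulrDl -[X in _ + X](mulr1 (2 * pi)) -mulrDr.
  by rewrite ler_pdivrMr // ler_wpM2l // mulr_ge0 ?ltW.
Qed.

(** * Poisson probability of a residue class *)

(** Passes from the unordered extended-real sum defining the Poisson measure to
an ordinary power series; the limit [l] is kept as a parameter so that callers
choose how to sum the series. *)
Lemma poisson_prob_cvg {R : realType} (rate : R) (i : nat) (A : pred nat) (l : R) :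
  0 < rate ->
  pseries (egf_terms (fun n => (A n)%:R)) rate @ \oo --> l ->
  poisson_prob rate i [set n | A n] = (expR (- rate) * l)%:E.
Proof.
move=> rate0 Al.
rewrite /poisson_prob rate0 -nneseries_esum; last first.
  by move=> n _; rewrite lee_fin poisson_pmf_ge0.
rewrite eseries_mkcond.
pose u n := expR (- rate) * pseries (egf_terms (fun n => (A n)%:R)) rate n.
have ul : u n @[n --> \oo] --> expR (- rate) * l by apply: cvgMr.
rewrite (_ : (fun n => _) = EFin \o u); last first.
  apply/funext => n; rewrite /u /pseries /series /= mulr_sumr -sumEFin.
  apply: eq_bigr => m _; rewrite /poisson_pmf rate0 /egf_terms.
  by case: (A m) => /=; congr (_%:E); ring.
by rewrite EFin_lim ?(cvg_lim _ ul) //; apply/cvg_ex; exists (expR (- rate) * l).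
Qed.

Lemma dvdn_addB (b n k : nat) : (k < b)%N ->
  (b %| n + (b - k))%N = (n == k %[mod b]).
Proof.
move=> kb; have kb' := ltnW kb.
by rewrite -(eqn_modDr (b - k)) (subnKC kb') modnn.
Qed.

(** Fourier inversion of the Poisson law on residues.  The shift is by b - k
rather than - k so that all angles are natural multiples of 2 pi j / b. *)
Lemma poisson_prob_mod {R : realType} (rate : R) (i b k : nat) :
  0 < rate -> (k < b)%N ->
  poisson_prob rate i [set n | n == k %[mod b]] =
  (b%:R^-1 * \sum_(0 <= j < b) expR (- rate) *
     egf (fun n => cos (n%:R * (2 * pi * j%:R / b%:R)
                        + (b - k)%:R * (2 * pi * j%:R / b%:R))) rate)%:E.
Proof.
move=> rate0 kb; have b0 : (0 < b)%N by exact: leq_ltn_trans kb.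
have bR : b%:R != 0 :> R by rewrite pnatr_eq0 -lt0n.
pose c j n : R := cos (n%:R * (2 * pi * j%:R / b%:R)
                        + (b - k)%:R * (2 * pi * j%:R / b%:R)).
rewrite -mulr_sumr mulrCA; apply: poisson_prob_cvg => //.
have c1 j n : `|c j n| <= 1 by exact: cos_max.
rewrite (_ : pseries _ _ = (fun m => b%:R^-1 *
   pseries (egf_terms (fun n => \sum_(j <- index_iota 0 b) c j n)) rate m)).
  by apply: cvgMr; exact: egf_sum c1.
apply/funext => m; rewrite /pseries /series /= mulr_sumr.
apply: eq_bigr => n _; rewrite /egf_terms -dvdn_addB //.
have -> : \sum_(0 <= j < b) c j n = (b %| n + (b - k))%:R * b%:R.
  by rewrite -sum_cos_roots //; apply: eq_bigr => j _; rewrite /c -mulrDl -natrD.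
by field; rewrite bR pnatr_eq0 -lt0n fact_gt0.
Qed.

Theorem theorem2p2 (d : measure_display) (T : measurableType d) (R : realType)
    (P : probability T R) (X : {RV P >-> nat}) (lambda : R) (b : nat)
    (hlambda : 0 < lambda) (hX : is_poisson X lambda) (hb : (2 <= b)%N)
    (k : nat) (hk : (k < b)%N) :
  `| fine (P [set t | (X t = k %[mod b])%N]) - 1 / b%:R |
    <= 1 / b%:R * \sum_(1 <= j < b)
         expR (- lambda * (1 - cos (2 * pi * j%:R / b%:R)))
    <= (b%:R - 1) / b%:R * expR (- lambda * (1 - cos (2 * pi / b%:R))).
Proof.
have b0 : (0 < b)%N by exact: leq_ltn_trans hk.
have bR : 0 < b%:R :> R by rewrite ltr0n.
apply/andP; split; last first.
  rewrite div1r mulrAC -(mulrC (b%:R^-1)) ler_pM2l ?invr_gt0 //.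
  apply: (@le_trans _ _ (\sum_(1 <= j < b)
      expR (- lambda * (1 - cos (2 * pi / b%:R))))).
    apply: ler_sum_nat => j /andP[j0 jb].
    rewrite ler_expR !mulNr lerN2 ler_pM2l // lerD2l lerN2.
    by apply: cos_root_le; rewrite j0.
  by rewrite sumr_const_nat -[leLHS]mulr_natl natrB.
have -> : P [set t | X t = k %[mod b]] =
    poisson_prob lambda 0 [set n | n == k %[mod b]].
  rewrite -hX /distribution /pushforward; congr (P _).
  by apply/seteqP; split => t /= /eqP.
rewrite poisson_prob_mod //= big_ltn //.
(* The term j = 0 is exactly 1/b. *)
under [X in egf X _]eq_fun => n.
  rewrite (_ : cos _ = 1); last by rewrite mulr0 mul0r !mulr0 addr0 cos0.
  over.
rewrite egf1 expRN mulVf ?expR_eq0 // mulrDr mulr1 div1r addrC addrA addNr add0r.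
rewrite normrM ger0_norm ?invr_ge0 ?ler0n // ler_pM2l ?invr_gt0 //.
apply: le_trans (ler_norm_sum _ _ _) _; apply: ler_sum => j _.
rewrite normrM ger0_norm ?invr_ge0 ?expR_ge0 // -expRN.
rewrite mulrBr mulr1 mulNr opprK expRD ler_pM2l ?expR_gt0 //.
exact: norm_egf_cos_le.
Qed.
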